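(* Let $(W,S)$ be an arbitrary Coxeter system. Then $S$ is a weak Sidon set in $W$, i.e. for every function $f\colon S\to[-1,1]$ there exist positive definite functions $\varphi_+,\varphi_-$ on $W$ such that $f(s)=\varphi_+(s)-\varphi_-(s)$ for every $s\in S$. One can take $\varphi_\pm=R_{\mathbf q^\pm}$ for a suitable choice of families $\mathbf q^\pm=(q^\pm_s)_{s\in S}$ of real numbers. Moreover, $$\|\varphi_+-\varphi_-\|_{B(W)}\le 2.$$
   Context: A Coxeter system $(W,S)$ is a group $W$ with a (possibly infinite) generating set $S$ and presentation $W=\langle S\mid (s_1s_2)^{m(s_1,s_2)}=1 \text{ whenever } m(s_1,s_2)\neq\infty\rangle$, where $m\colon S\times S\to\{1,2,\dots,\infty\}$ is symmetric and $m(s_1,s_2)=1$ iff $s_1=s_2$. For $w\in W$ the colour $S_w\subseteq S$ is the (finite) set of generators occurring in a reduced word (word of minimal length in $S$) of $w$; it does not depend on the reduced word. For $\mathbf q=(q_s)_{s\in S}$ the Riesz–Coxeter function is $R_{\mathbf q}(w)=\prod_{s\in S_w}q_s$. A function $\varphi\colon\Gamma\to\mathbb{C}$ on a group $\Gamma$ is positive definite if $\sum_{x,y\in\Gamma}\varphi(y^{-1}x)\alpha(x)\overline{\alpha(y)}\ge 0$ for every finitely supported $\alpha\colon\Gamma\to\mathbb{C}$. The Fourier–Stieltjes algebra $B(\Gamma)$ is the set of all $f=\varphi_1-\varphi_2+i(\varphi_3-\varphi_4)$ with $\varphi_1,\dots,\varphi_4$ positive definite on $\Gamma$, with norm $\|f\|_{B(\Gamma)}=\inf\sum_{i=1}^4\varphi_i(e)$,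 the infimum over all such decompositions of $f$. The inequality refers to the functions $\varphi_\pm=R_{\mathbf q^\pm}$. *)

(* Defs.v *)
From HB Require Import structures.
From mathcomp Require Import all_boot all_order all_algebra.
From mathcomp Require Import complex.
From mathcomp Require Import all_classical all_reals.

Set Implicit Arguments.
Unset Strict Implicit.
Unset Printing Implicit Defensive.

Import Order.TTheory GRing.Theory Num.Theory.

Local Open Scope classical_set_scope.
Local Open Scope ring_scope.
Local Open Scope complex_scope.

Section Presentation.
Variables (G : groupType) (X : set G).

(* A word in the letters X and X^-1; (x, true) stands for x, (x, false) for
   x^-1. *)
Definition gword := seq (X * bool).

Definition gword_val (u : gword) : G :=
  (\prod_(a <- u) if a.2 then val a.1 else (val a.1)^-1)%g.

(* The congruence on words whose quotient is the free group on X modulo the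
   normal closure of the relators. *)
Inductive pres_eq (rel : gword -> Prop) : gword -> gword -> Prop :=
| pres_refl u : pres_eq rel u u
| pres_sym u v : pres_eq rel u v -> pres_eq rel v u
| pres_trans u v w : pres_eq rel u v -> pres_eq rel v w -> pres_eq rel u w
| pres_cat u v u' v' :
    pres_eq rel u v -> pres_eq rel u' v' -> pres_eq rel (u ++ u') (v ++ v')
| pres_cancel x b : pres_eq rel [:: (x, b); (x, ~~ b)] [::]
| pres_relator r : rel r -> pres_eq rel r [::].

Definition presentation (rel : gword -> Prop) : Prop :=
  (forall g : G, exists u, gword_val u = g) /\
  (forall u v, gword_val u = gword_val v <-> pres_eq rel u v).

End Presentation.

Section Coxeter.
Variables (W : groupType) (S : set W).

(* The value 0 of m encodes infinity. *)
Definition coxeter_relator (m : S -> S -> nat) (r : gword S) : Prop :=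
  exists s t : S, m s t <> 0%N /\
    r = flatten (nseq (m s t) [:: (s, true); (t, true)]).

Definition coxeter_system (m : S -> S -> nat) : Prop :=
  [/\ forall s t, m s t = m t s,
      forall s t, m s t = 1%N <-> s = t
    & presentation (coxeter_relator m)].

Definition word_prod (u : seq S) : W := (\prod_(s <- u) val s)%g.

Definition reduced_word (w : W) (u : seq S) : Prop :=
  word_prod u = w /\ forall v, word_prod v = w -> (size u <= size v)%N.

Definition colour (w : W) : set S :=
  [set s | exists2 u, reduced_word w u & s \in u].

(* This finitely supported product is the genuine product over the colour,
   which is finite in a Coxeter system: reduced words of the same element have
   the same letters. *)
Definition riesz_coxeter (R : realType) (q : S -> R) (w : W) : R[i] :=
  (\big[*%R/1]_(s \in colour w) q s)%:C.

End Coxeter.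

Section PositiveDefinite.
Variables (R : realType) (G : groupType).
Implicit Types (phi f : G -> R[i]).

Definition positive_definite phi : Prop :=
  forall alpha : G -> R[i], finite_set [set x | alpha x != 0] ->
    0 <= \sum_(x \in [set: G]) \sum_(y \in [set: G])
           phi (y^-1 * x)%g * alpha x * (alpha y)^*.

Definition FS_decomposition f (phi1 phi2 phi3 phi4 : G -> R[i]) : Prop :=
  [/\ positive_definite phi1, positive_definite phi2,
      positive_definite phi3, positive_definite phi4
    & forall x, f x = phi1 x - phi2 x + 'i * (phi3 x - phi4 x)].

Definition fourier_stieltjes f : Prop :=
  exists phi1 phi2 phi3 phi4, FS_decomposition f phi1 phi2 phi3 phi4.

(* Real infimum, meaningful only when f belongs to the Fourier-Stieltjes
   algebra: the values at 1 of positive definite functions are real and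
   nonnegative, so the set is then nonempty and bounded below by 0. *)
Definition FS_norm f : R :=
  inf [set r : R | exists phi1 phi2 phi3 phi4,
    FS_decomposition f phi1 phi2 phi3 phi4 /\
    r%:C = phi1 1%g + phi2 1%g + phi3 1%g + phi4 1%g].

Definition weak_sidon (S : set G) : Prop :=
  forall f : S -> R, (forall s, -1 <= f s <= 1) ->
    exists phip phim : G -> R[i],
      [/\ positive_definite phip, positive_definite phim
        & forall s : S, (f s)%:C = phip (val s) - phim (val s)].

End PositiveDefinite.

(* Main.v *)
Require Import Defs.
From mathcomp Require Import all_boot all_order all_algebra.
From mathcomp Require Import complex lra.
From mathcomp Require Import all_classical all_reals.

Set Implicit Arguments.
Unset Strict Implicit.
Unset Printing Implicit Defensive.

Import Order.TTheory GRing.Theory Num.Theory.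

Local Open Scope classical_set_scope.
Local Open Scope ring_scope.
Local Open Scope complex_scope.

(** If every [q s] lies in [0, 1], draw a random subset [T] of [S] by keeping
    each generator [s] independently with probability [q s].  The Riesz-Coxeter
    function is then a probability:
      R_q(w) = P (colour w `<=` T),
    so it is an average of indicator functions of the sets
    W_T = [set w | colour w `<=` T].  Each W_T is a subgroup of [W], and the
    indicator of a subgroup is positive definite: its Gram form is the sum,
    over the left cosets, of the squared modulus of the total weight of the
    coset.  Hence R_q is positive definite.  A function f with values in
    [-1, 1] is the difference of its positive and negative parts, which have
    values in [0, 1]; since R_q takes the value q s at s and 1 at the unit, they
    provide the decomposition, and its total mass at the unit is 1 + 1 = 2.

    That W_T is a subgroup amounts to [reduced_word_letters]: the letters of a
    reduced word of w occur in every word of w.  This rests on Tits' cocycle: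
    a word s_1 ... s_k determines the reflections
    s_1 ... s_(i-1) s_i s_(i-1) ... s_1, and the parity of the number of times
    that a given element occurs among them depends only on the product of the
    word ([word_prod_reflection_parity]).  By the presentation of [W]
    it suffices to see that the parity is unchanged by the relators, and the
    reflections of (s t)^m run twice through the same m elements.  The exchange
    and deletion properties follow, and give the claim on letters.  In
    particular the colours are finite, so that on finitely many group elements
    only finitely many generators matter, and the average above can be computed
    by deciding the membership in T of one generator at a time
    ([riesz_mixture_cons]). *)

(** * Words and their reflections *)

Section Words.
Variables (W : groupType) (S : set W).
Implicit Types (s : S) (u v : seq S) (t : W).

Lemma word_prod_nil : word_prod ([::] : seq S) = 1%g.
Proof. by rewrite /word_prod big_nil. Qed.

Lemma word_prod_cons s u : word_prod (s :: u) = (val s * word_prod u)%g.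
Proof. by rewrite /word_prod big_cons. Qed.

Lemma word_prod_cat u v : word_prod (u ++ v) = (word_prod u * word_prod v)%g.
Proof. by rewrite /word_prod big_cat. Qed.

(** The conjugation by [(val s)^-1] is [t |-> s t s^-1]; with this convention
    the concatenation formula below holds in any group, before the generators
    are known to be involutions. *)
Fixpoint reflections u : seq W :=
  if u is s :: u' then
    val s :: [seq (t ^ (val s)^-1)%g | t <- reflections u']
  else [::].

Lemma size_reflections u : size (reflections u) = size u.
Proof. by elim: u => //= s u IH; rewrite size_map IH. Qed.

Lemma reflections_cat u v :
  reflections (u ++ v) =
  reflections u ++ [seq (t ^ (word_prod u)^-1)%g | t <- reflections v].
Proof.
elim: u => [|s u IH] /=.
  by rewrite word_prod_nil invg1 map_id_in // => t _; rewrite conjg1.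
rewrite IH map_cat -map_comp; congr (_ :: (_ ++ _)).
by apply: eq_map => t /=; rewrite word_prod_cons invgM conjgM.
Qed.

(** The value at [t] of Tits' cocycle. *)
Definition reflection_parity u t := odd (count_mem t (reflections u)).

Lemma reflection_parity_cat u v t :
  reflection_parity (u ++ v) t =
  reflection_parity u t (+) reflection_parity v (t ^ word_prod u)%g.
Proof.
rewrite /reflection_parity reflections_cat count_cat oddD count_map.
congr (_ (+) odd _); apply: eq_count => t' /=.
by apply/eqP/eqP => [<-|->]; rewrite -conjgM ?mulVg ?mulgV conjg1.
Qed.


End Words.

(** * Exchange, deletion and reduced words *)

Section CoxeterSystem.
Variables (W : groupType) (S : set W) (m : S -> S -> nat).
Hypothesis hWS : coxeter_system m.
Implicit Types (s : S) (u v : seq S) (w : W).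

Let word_of (u : gword S) : seq S := [seq a.1 | a <- u].

Lemma generator_involutive s : (val s * val s = 1)%g.
Proof.
have [_ m1 [_ presW]] := hWS.
have mss : m s s = 1%N by apply/m1.
have /presW : pres_eq (coxeter_relator m) [:: (s, true); (s, true)] [::].
  by apply: pres_relator; exists s, s; rewrite mss.
by rewrite /gword_val !big_cons big_nil /= mulg1.
Qed.

(** Inverse letters may thus be replaced by the letters themselves, and the
    presentation can be used on words in [S]. *)
Lemma generatorV s : ((val s)^-1 = val s)%g.
Proof. exact/mulg1_eq/generator_involutive. Qed.

Lemma gword_valE (u : gword S) : gword_val u = word_prod (word_of u).
Proof.
rewrite /gword_val /word_prod big_map; apply: eq_bigr => -[s b] _ /=.
by rewrite generatorV if_same.
Qed.

Lemma generated w : exists u, word_prod u = w.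
Proof.
have [_ _ [/(_ w)[u <-] _]] := hWS.
by exists (word_of u); rewrite gword_valE.
Qed.

Lemma word_prod_rev u : word_prod (rev u) = ((word_prod u)^-1)%g.
Proof.
elim: u => [|s u IH]; first by rewrite word_prod_nil invg1.
rewrite rev_cons -cats1 word_prod_cat IH !word_prod_cons word_prod_nil mulg1.
by rewrite invgM generatorV.
Qed.

(** Conjugation by [s t] sends [(s t)^j s] to [(s t)^(j+2) s], since
    [s (s t)^-1 = (s t) s]. *)
Lemma reflections_dihedral s t k :
  reflections (flatten (nseq k [:: s; t])) =
  [seq ((val s * val t) ^+ j * val s)%g | j <- iota 0 k.*2].
Proof.
elim: k => // k IH.
rewrite -[flatten _]/([:: s; t] ++ flatten (nseq k [:: s; t])).
rewrite reflections_cat IH /=.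
rewrite conjgE invgK generatorV mul1g !mulgA.
rewrite (iotaDl 2 0) -!map_comp; congr [:: _, _ & _]; apply: eq_map => j /=.
rewrite !word_prod_cons word_prod_nil mulg1 conjgE invgK invgM !generatorV.
by rewrite -[(2 + j)%N]/(j.+2) expgS expgSr !mulgA.
Qed.

(** As [(s t)^k = 1] for [k = m s t], the sequence [(s t)^j s], [j < 2 k], is
    [k]-periodic, and every element occurs in it an even number of times. *)
Lemma reflection_parity_relator (r : gword S) x :
  coxeter_relator m r -> reflection_parity (word_of r) x = false.
Proof.
move=> mr; have := mr => -[s [t [_ defr]]].
have [_ _ [_ presW]] := hWS.
have /presW : pres_eq (coxeter_relator m) r [::] by exact: pres_relator.
rewrite gword_valE /gword_val big_nil.
have -> : word_of r = flatten (nseq (m s t) [:: s; t]).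
  by rewrite defr /word_of map_flatten map_nseq.
set k := m s t => st1.
have {}st1 : ((val s * val t) ^+ k = 1)%g.
  rewrite -st1; elim: (k) => [|i IH] /=; first by rewrite expg0 word_prod_nil.
  by rewrite !word_prod_cons -IH expgS mulgA.
rewrite /reflection_parity reflections_dihedral -addnn iotaD map_cat count_cat.
rewrite add0n (_ : [seq _ | j <- iota k k] =
  [seq ((val s * val t) ^+ j * val s)%g | j <- iota 0 k]).
  by rewrite addnn odd_double.
rewrite -[X in iota X k]addn0 [in LHS]iotaDl -map_comp.
by apply: eq_map => j /=; rewrite expgnDr st1 mul1g.
Qed.

Lemma pres_eq_reflection_parity (u v : gword S) x :
  pres_eq (coxeter_relator m) u v ->
  reflection_parity (word_of u) x = reflection_parity (word_of v) x.
Proof.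
have [_ _ [_ presW]] := hWS.
move=> uv; elim: uv x => {u v} //=.
- by move=> u v w _ IH1 _ IH2 x; rewrite IH1.
- move=> u v u' v' uv IH _ IH' x.
  rewrite /word_of !map_cat !reflection_parity_cat IH IH' -!gword_valE.
  by move/presW: uv => ->.
- move=> s b x; rewrite /reflection_parity /= conjgE mulgV mulg1 invgK.
  by rewrite addnA addn0 addnn odd_double.
- by move=> r mr x; rewrite reflection_parity_relator.
Qed.

(** The cocycle is a function on the group.  Since it detects the reflections
    that occur an odd number of times, it forces different words of the same
    element to share these. *)
Lemma word_prod_reflection_parity u v :
  word_prod u = word_prod v -> reflection_parity u =1 reflection_parity v.
Proof.
pose lift u : gword S := [seq (s, true) | s <- u].
have liftK u' : word_of (lift u') = u' by rewrite /word_of -map_comp map_id.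
have [_ _ [_ presW]] := hWS.
move=> uv x; rewrite -(liftK u) -(liftK v); apply: pres_eq_reflection_parity.
by apply/presW; rewrite !gword_valE !liftK.
Qed.

(** Left multiplication by the [i]-th reflection erases the [i]-th letter. *)
Lemma exchange u t : t \in reflections u ->
  exists v, [/\ (size v < size u)%N, {subset v <= u}
              & word_prod v = (t * word_prod u)%g].
Proof.
elim: u t => //= s u IH t; rewrite inE.
case/orP=> [/eqP->|/mapP[t' /IH[v [lt_vu vu vE]] ->]].
  exists u; split=> //; first by move=> x xu; rewrite inE xu orbT.
  by rewrite word_prod_cons mulgA generator_involutive mul1g.
exists (s :: v); split=> //=.
  by move=> x; rewrite !inE => /orP[->//|/vu->]; rewrite orbT.
by rewrite !word_prod_cons vE conjgE invgK !mulgA mulgVK.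
Qed.

(** If two reflections of [s_1 ... s_k] coincide, say the [i]-th and the [j]-th,
    their product is trivial, and multiplying by it erases two letters. *)
Lemma deletion u : ~~ uniq (reflections u) ->
  exists v, [/\ (size v < size u)%N, {subset v <= u}
              & word_prod v = word_prod u].
Proof.
elim: u => //= s u IH; rewrite negb_and negbK => /orP[/mapP[t tu st]|].
  have [v [lt_vu vu vE]] := exchange tu.
  exists v; split=> [||]; first exact: leqW.
    by move=> x /vu xu; rewrite inE xu orbT.
  rewrite vE word_prod_cons; congr (_ * _)%g.
  by apply: (conjg_inj (val s)^-1%g); rewrite -st conjgE mulgV mulg1 invgK.
rewrite map_inj_uniq; last exact: conjg_inj.
move=> /IH[v [lt_vu vu vE]]; exists (s :: v); split=> //=.
  by move=> x; rewrite !inE => /orP[->//|/vu->]; rewrite orbT.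
by rewrite !word_prod_cons vE.
Qed.

(** When the reflections of [u] are distinct, each has odd parity, hence occurs
    among the reflections of any other word of the same element, which then has
    at least as many letters. *)
Lemma uniq_reflections_reduced u :
  uniq (reflections u) -> reduced_word (word_prod u) u.
Proof.
move=> uniq_u; split=> // v vu.
rewrite -(size_reflections u) -(size_reflections v).
apply: uniq_leq_size => // t tu.
have := word_prod_reflection_parity vu t.
rewrite /reflection_parity (count_uniq_mem _ uniq_u) tu /=.
by rewrite -has_pred1 has_count; case: (count _ _).
Qed.

Lemma reduced_word_uniq w u : reduced_word w u -> uniq (reflections u).
Proof.
move=> [<- min_u]; apply/negPn/negP => /deletion[v [lt_vu _ /min_u]].
by rewrite leqNgt lt_vu.
Qed.

(** Deletion only erases letters: an element of the subgroup generated by some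
    letters has a reduced word in these letters. *)
Lemma reduced_subword u :
  exists2 v, {subset v <= u} & reduced_word (word_prod u) v.
Proof.
have [n] := ubnP (size u); elim: n u => // n IH u; rewrite ltnS => lt_un.
have [/uniq_reflections_reduced ru|/deletion[v [lt_vu vu <-]]] :=
  boolP (uniq (reflections u)); first by exists u.
have [v' v'v rv'] := IH v (leq_trans lt_vu lt_un).
by exists v' => // x /v'v/vu.
Qed.

(** The parity at [s] separates the word [s] from the empty word. *)
Lemma generator_neq1 s : val s <> 1%g.
Proof.
move=> s1; have : word_prod [:: s] = word_prod ([::] : seq S).
  by rewrite word_prod_cons word_prod_nil mulg1.
move=> /word_prod_reflection_parity/(_ (val s)).
by rewrite /reflection_parity /= eqxx.
Qed.

Lemma generator_subword s u : word_prod u = val s -> s \in u.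
Proof.
move=> us; have [v vu [vE min_v]] := reduced_subword u.
have := min_v [:: s]; rewrite us word_prod_cons word_prod_nil mulg1.
move=> /(_ erefl); case: v vu vE {min_v} => [|s' [|//]] vu.
  by rewrite us word_prod_nil => /esym/generator_neq1.
rewrite us word_prod_cons word_prod_nil mulg1 => /val_inj s's _.
by apply: vu; rewrite s's mem_head.
Qed.

(** The first letter [s] of a reduced word [u] is a reflection of [u] with odd
    parity, so it is a reflection of [v], and exchange writes [s] as a product
    of letters of [v]; by [generator_subword] it is one of them.  Then [s w],
    of which the tail of [u] is a reduced word, is again a product of letters
    of [v]. *)
Lemma reduced_word_letters w u v :
  reduced_word w u -> word_prod v = w -> {subset u <= v}.
Proof.
move=> /[dup] /reduced_word_uniq uniq_u [uE _] vE.
have {uE vE} : word_prod u = word_prod v by rewrite vE.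
elim: u v uniq_u => // s u IH v uniq_u uv.
have s_v : s \in v.
  have : val s \in reflections v.
    have := word_prod_reflection_parity uv (val s).
    rewrite /reflection_parity (count_uniq_mem _ uniq_u) mem_head /=.
    by rewrite -has_pred1 has_count; case: (count _ _).
  move=> /exchange[v' [_ v'v v'E]].
  have /generator_subword : word_prod (v' ++ rev v) = val s.
    by rewrite word_prod_cat word_prod_rev v'E mulgK.
  by rewrite mem_cat mem_rev => /orP[/v'v|].
have {}uniq_u : uniq (reflections u).
  by move: uniq_u => /= /andP[_]; rewrite map_inj_uniq //; exact: conjg_inj.
move=> x; rewrite inE => /orP[/eqP->//|xu].
have /(_ _ xu) : {subset u <= s :: v}.
  apply: IH => //; rewrite word_prod_cons -uv word_prod_cons mulgA.
  by rewrite generator_involutive mul1g.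
by rewrite inE => /orP[/eqP->|].
Qed.

Lemma colour_sub w u : word_prod u = w -> colour w `<=` [set` u].
Proof. by move=> uE s [v rv sv]; apply: reduced_word_letters uE s sv. Qed.

(** As generators are involutions, the right-hand side describes the subgroup
    generated by [A]. *)
Lemma colour_spanP (A : set S) w :
  colour w `<=` A <-> exists2 u, word_prod u = w & [set` u] `<=` A.
Proof.
split=> [wA|[u uE uA]]; last exact: subset_trans (colour_sub uE) uA.
have [u0 u0E] := generated w; have [u _] := reduced_subword u0.
rewrite u0E => ru; exists u; first by case: ru.
by move=> s us; apply: wA; exists u.
Qed.

Lemma colour1 : colour (1 : W)%g = set0 :> set S.
Proof. by rewrite -subset0 => s /(colour_sub (word_prod_nil S)). Qed.

Lemma colour_generator s : colour (val s) = [set s].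
Proof.
have sE : word_prod [:: s] = val s.
  by rewrite word_prod_cons word_prod_nil mulg1.
apply/seteqP; split=> [x /(colour_sub sE)|_ ->].
  by rewrite /= inE => /eqP.
exists [:: s]; last exact: mem_head.
split=> // -[|//]; by rewrite word_prod_nil => /esym/generator_neq1.
Qed.

Lemma colour_sub_seq w : exists u, colour w `<=` [set` u].
Proof. by have [u /colour_sub] := generated w; exists u. Qed.

Lemma parabolic_subgroup (A : set S) x y :
  colour x `<=` A -> colour y `<=` A -> colour (x^-1 * y)%g `<=` A.
Proof.
move=> /colour_spanP[u <- uA] /colour_spanP[v <- vA].
apply/colour_spanP; exists (rev u ++ v).
  by rewrite word_prod_cat word_prod_rev.
by move=> s /=; rewrite mem_cat mem_rev => /orP[/uA|/vA].
Qed.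

End CoxeterSystem.

(** * Positive definite functions *)

Section PositiveForms.
Variables (R : realType) (G : groupType).
Implicit Types (phi : G -> R[i]) (X : seq G) (alpha : G -> R[i]).

(** Working with arbitrary sequences of points makes it possible to treat a
    function through another one that agrees with it only on the quotients
    [y^-1 x] of these points. *)
Definition gram_form phi X alpha : R[i] :=
  \sum_(x <- X) \sum_(y <- X) phi (y^-1 * x)%g * alpha x * (alpha y)^*.

Lemma fsum_setT (X : seq G) (f : G -> R[i]) :
  uniq X -> (forall x, x \notin X -> f x = 0) ->
  \sum_(x \in [set: G]) f x = \sum_(x <- X) f x.
Proof.
move=> uniqX f0; rewrite (fsbigE X) //; last by move=> x _; exact: f0.
by apply: eq_bigl => x; rewrite in_setT.
Qed.

Lemma gram_form_ge0_positive_definite phi :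
  (forall X alpha, 0 <= gram_form phi X alpha) -> positive_definite phi.
Proof.
move=> phi_ge0 alpha fin_alpha.
have [X0 X0E] := (finite_seqP _).1 fin_alpha; pose X := undup X0.
have alpha0 x : x \notin X -> alpha x = 0.
  move=> xX; apply/eqP/negPn/negP => ax.
  have : [set` X0] x by rewrite -X0E.
  by rewrite /= -mem_undup (negbTE xX).
have sumX (f : G -> R[i]) : (forall x, alpha x = 0 -> f x = 0) ->
    \sum_(x \in [set: G]) f x = \sum_(x <- X) f x.
  by move=> f0; apply: fsum_setT => [|x /alpha0/f0//]; exact: undup_uniq.
rewrite sumX; last first.
  by move=> x ax; rewrite fsbig1 // => y _; rewrite ax mulr0 mul0r.
suff -> : \sum_(x <- X) \sum_(y \in [set: G])
    phi (y^-1 * x)%g * alpha x * (alpha y)^* = gram_form phi X alpha by [].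
apply: eq_bigr => x _; apply: sumX => y ->.
by rewrite rmorph0 mulr0.
Qed.

Lemma positive_definite1_ge0 phi : positive_definite phi -> 0 <= phi 1%g.
Proof.
move=> /(_ (fun x => (x == 1%g)%:R)).
have -> : [set x | ((x == 1%g)%:R : R[i]) != 0] = [set 1%g : G].
  apply/seteqP; split=> x; rewrite /= pnatr_eq0 eqb0 negbK; last by move->.
  by move/eqP.
move=> /(_ (finite_set1 _)).
rewrite (@fsum_setT [:: 1%g]) //=; last first.
  move=> x; rewrite inE => /negbTE x1; rewrite fsbig1 // => y _.
  by rewrite x1 mulr0 mul0r.
rewrite big_seq1 (@fsum_setT [:: 1%g]) //=; last first.
  by move=> y; rewrite inE => /negbTE ->; rewrite rmorph0 mulr0.
by rewrite big_seq1 eqxx mulr1 rmorph1 mulr1 invg1 mul1g.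
Qed.

(** The form is diagonal in the left cosets of [P]: with [c k] the sum of the
    weights in the [k]-th coset, its value is the sum of the [|c k|^2]. *)
Lemma gram_form_subgroup_ge0 (P : set G) X alpha :
  P 1%g -> (forall x y, P x -> P y -> P (x^-1 * y)%g) ->
  0 <= gram_form (fun w => (w \in P)%:R) X alpha.
Proof.
move=> P1 PVM.
have PV x : P x -> P (x^-1)%g.
  by move=> Px; rewrite -[(x^-1)%g]mulg1; apply: PVM.
(* The coset of x is encoded by the position of its first element in X. *)
pose rep x := find (fun z => (z^-1 * x)%g \in P) X.
have repP x : x \in X -> (rep x < size X)%N /\ P ((nth 1%g X (rep x))^-1 * x)%g.
  move=> xX; have hasx : has (fun z => (z^-1 * x)%g \in P) X.
    by apply/hasP; exists x => //; rewrite mulVg inE.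
  by split; [rewrite /rep -has_find|apply/set_mem/(nth_find 1%g hasx)].
have repE x y : x \in X -> y \in X ->
    ((y^-1 * x)%g \in P) = (rep x == rep y).
  move=> xX yX; apply/idP/eqP => [/set_mem Pyx|repxy].
    apply: eq_find => z; apply/idP/idP => /set_mem Pz; apply/mem_set.
      have := PVM _ _ (PV _ Pz) (PV _ Pyx).
      by rewrite invgK invgM invgK -mulgA mulVKg.
    have := PVM _ _ (PV _ Pz) Pyx.
    by rewrite invgK -mulgA mulVKg.
  have [_] := repP _ yX; have [_] := repP _ xX; rewrite repxy => Px Py.
  apply/mem_set; have := PVM _ _ Py Px.
  by rewrite invgM invgK -mulgA mulVKg.
pose c k := \sum_(x <- X | rep x == k) alpha x.
suff -> : gram_form (fun w => (w \in P)%:R) X alpha =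
    \sum_(k < size X) c k * (c k)^*.
  by apply: sumr_ge0 => k _; exact: mul_conjC_ge0.
have cE (k : 'I_(size X)) : c k * (c k)^* = \sum_(x <- X) \sum_(y <- X)
   (rep x == k)%:R * (rep y == k)%:R * (alpha x * (alpha y)^*).
  rewrite /c rmorph_sum.
  rewrite mulr_suml [LHS]big_mkcond; apply: eq_bigr => x _.
  case: eqP => _; last by rewrite big1 // => y _; rewrite !mul0r.
  rewrite mulr_sumr [LHS]big_mkcond; apply: eq_bigr => y _.
  by case: eqP => _; rewrite !mul1r ?mul0r.
under eq_bigr do rewrite cE.
rewrite exchange_big /=; apply: eq_big_seq => x xX.
rewrite exchange_big /=; apply: eq_big_seq => y yX.
rewrite -mulr_suml repE // mulrA; congr (_ * _ * _).
have [ltx _] := repP _ xX.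
rewrite (bigD1 (Ordinal ltx)) //= eqxx mul1r big1 ?addr0 ?[rep y == _]eq_sym //.
move=> k; rewrite -val_eqE /= => /negbTE; rewrite eq_sym => ->.
by rewrite mul0r.
Qed.
End PositiveForms.

(** * Riesz-Coxeter functions as averages over parabolic subgroups *)

Section RieszCoxeter.
Variables (R : realType) (W : groupType) (S : set W) (m : S -> S -> nat).
Hypothesis hWS : coxeter_system m.
Implicit Types (q : S -> R) (L : seq S) (A : set S) (w : W).

Lemma finite_colour_seq (X : seq W) :
  exists2 L : seq S, uniq L & forall w, w \in X -> colour w `<=` [set` L].
Proof.
elim: X => [|w X [L _ subL]]; first by exists [::].
have [u wu] := colour_sub_seq hWS w.
exists (undup (u ++ L)); first exact: undup_uniq.
move=> x; rewrite inE => /orP[/eqP->|/subL xL] s.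
  by move=> /wu /=; rewrite mem_undup mem_cat => ->.
by move=> /xL /=; rewrite mem_undup mem_cat orbC => ->.
Qed.

(** For [L] without repetitions and disjoint from [A], the probability that
    [colour w] is contained in the random set which contains [A], contains each
    [s] in [L] independently with probability [q s], and has no other
    element. *)
Definition riesz_mixture q L A w : R :=
  if `[< colour w `<=` A `|` [set` L] >]
  then \prod_(s <- L | s \in colour w) q s else 0.

(** Conditioning on whether the random set contains [s]. *)
Lemma riesz_mixture_cons q s L A w : ~ A s -> s \notin L ->
  riesz_mixture q (s :: L) A w =
  q s * riesz_mixture q L (A `|` [set s]) w + (1 - q s) * riesz_mixture q L A w.
Proof.
move=> As sL; rewrite /riesz_mixture big_cons.
have -> : A `|` [set` s :: L] = A `|` [set s] `|` [set` L].
  rewrite -setUA; congr (_ `|` _); apply/seteqP; split=> x /=; rewrite inE.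
    by case/orP=> [/eqP|]; [left|right].
  by case=> [->|->]; rewrite ?eqxx ?orbT.
case: asboolP => [|nsub]; last first.
  rewrite mulr0 add0r; case: asboolP => [sub|_]; last by rewrite mulr0.
  by case: nsub => x /sub[]; [left; left|right].
move=> sub; case: ifPn => [/set_mem sw|/negP sw].
  case: asboolP => [/(_ _ sw)[//|/=]|_]; first by rewrite (negbTE sL).
  by rewrite mulr0 addr0.
case: asboolP => [_|[]]; first by rewrite -mulrDl addrC subrK mul1r.
move=> x /[dup] xw /sub[[Ax|xs]|xL]; [by left| |by right].
by case: sw; rewrite -xs; apply/mem_set.
Qed.

Lemma riesz_mixture_gram_form_ge0 q L A (X : seq W) alpha :
  (forall s, 0 <= q s <= 1) -> uniq L -> (forall s, s \in L -> ~ A s) ->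
  0 <= gram_form (fun w => (riesz_mixture q L A w)%:C) X alpha.
Proof.
move=> q01; elim: L A => [|s L IH] A /=.
  move=> _ _.
  have -> : (fun w => (riesz_mixture q [::] A w)%:C) =
            (fun w => (w \in [set w | colour w `<=` A])%:R).
    apply/funext => w; rewrite /riesz_mixture big_nil.
    have -> : A `|` [set` [::]] = A by apply/seteqP; split=> x; [case|left].
    by case: asboolP => wA; [rewrite mem_set|rewrite memNset];
      rewrite ?rmorph1 ?rmorph0.
  apply: gram_form_subgroup_ge0; first by rewrite /= (colour1 hWS).
  by move=> x y; exact: parabolic_subgroup hWS _ _ _.
move=> /andP[sL uniqL] LA.
have As : ~ A s by apply: LA; exact: mem_head.
have -> : gram_form (fun w => (riesz_mixture q (s :: L) A w)%:C) X alpha =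
  (q s)%:C *
    gram_form (fun w => (riesz_mixture q L (A `|` [set s]) w)%:C) X alpha
  + (1 - q s)%:C * gram_form (fun w => (riesz_mixture q L A w)%:C) X alpha.
  rewrite /gram_form !mulr_sumr -big_split; apply: eq_bigr => x _ /=.
  rewrite !mulr_sumr -big_split; apply: eq_bigr => y _ /=.
  by rewrite riesz_mixture_cons // rmorphD !rmorphM !mulrDl !mulrA.
have /andP[q0 q1] := q01 s.
apply: addr_ge0; apply: mulr_ge0; rewrite ?ler0c ?subr_ge0 //;
  apply: IH => // x xL.
  by case=> [|xs]; [apply: LA; rewrite inE xL orbT|rewrite -xs xL in sL].
by apply: LA; rewrite inE xL orbT.
Qed.

Lemma riesz_coxeterE q L w : uniq L -> colour w `<=` [set` L] ->
  riesz_coxeter q w = (\prod_(s <- L | s \in colour w) q s)%:C.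
Proof.
move=> uniqL wL; rewrite /riesz_coxeter; congr (_%:C).
rewrite [RHS]bigfs //; last by move=> s /set_mem/wL /= ->.
by apply: eq_fsbigl; apply/seteqP; split=> s; [move/mem_set|move/set_mem].
Qed.

Lemma riesz_coxeter_positive_definite q :
  (forall s, 0 <= q s <= 1) -> positive_definite (riesz_coxeter q).
Proof.
move=> q01; apply: gram_form_ge0_positive_definite => X alpha.
have [L uniqL subL] :=
  finite_colour_seq [seq (y^-1 * x)%g | x <- X, y <- X].
have := @riesz_mixture_gram_form_ge0 q L set0 X alpha q01 uniqL (fun _ _ => id).
congr (0 <= _); apply: eq_big_seq => x xX; apply: eq_big_seq => y yX.
have wL : colour (y^-1 * x)%g `<=` [set` L].
  by apply: subL; apply/allpairsP; exists (x, y).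
by rewrite (riesz_coxeterE q uniqL wL) /riesz_mixture set0U asboolT.
Qed.

Lemma riesz_coxeter1 q : riesz_coxeter q (1 : W)%g = 1.
Proof. by rewrite /riesz_coxeter (colour1 hWS) fsbig_set0. Qed.

Lemma riesz_coxeter_generator q s : riesz_coxeter q (val s) = (q s)%:C.
Proof. by rewrite /riesz_coxeter (colour_generator hWS) fsbig_set1. Qed.

End RieszCoxeter.

(** The infimum defining the norm is taken over a set of reals bounded below by
    [0], by [positive_definite1_ge0]; it is therefore at most the mass of the
    given decomposition. *)
Lemma FS_norm_sub_le (R : realType) (G : groupType) (phi psi : G -> R[i])
    (r : R) : positive_definite phi -> positive_definite psi ->
    phi 1%g + psi 1%g = r%:C ->
  fourier_stieltjes (fun x => phi x - psi x) /\
  FS_norm (fun x => phi x - psi x) <= r.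
Proof.
move=> pd_phi pd_psi r_eq.
have pd0 : positive_definite ((fun=> 0) : G -> R[i]).
  move=> alpha _; rewrite fsbig1 // => x _; rewrite fsbig1 // => y _.
  by rewrite !mul0r.
have dec :
    FS_decomposition (fun x => phi x - psi x) phi psi (fun=> 0) (fun=> 0).
  by split=> // x; rewrite subrr mulr0 addr0.
split; first by exists phi, psi, (fun=> 0), (fun=> 0).
apply: ge_inf; last first.
  by exists phi, psi, (fun=> 0), (fun=> 0); split=> //; rewrite !addr0 r_eq.
exists 0 => x [p1 [p2 [p3 [p4 [[pd1 pd2 pd3 pd4 _] E]]]]].
by rewrite -ler0c E !addr_ge0 // positive_definite1_ge0.
Qed.

(** * Weak Sidon sets *)

Theorem theorem8p1 (R : realType) (W : groupType) (S : set W)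
    (m : S -> S -> nat) (hWS : coxeter_system m) :
  weak_sidon R S /\
  (forall f : S -> R, (forall s : S, -1 <= f s <= 1) ->
    exists qp qm : S -> R,
      [/\ positive_definite (riesz_coxeter qp),
          positive_definite (riesz_coxeter qm),
          forall s : S, (f s)%:C =
            riesz_coxeter qp (val s) - riesz_coxeter qm (val s),
          fourier_stieltjes
            (fun w : W => riesz_coxeter qp w - riesz_coxeter qm w)
        & FS_norm (fun w : W => riesz_coxeter qp w - riesz_coxeter qm w)
            <= 2]).
Proof.
have split_sign (f : S -> R) : (forall s, -1 <= f s <= 1) ->
  exists qp qm : S -> R, [/\ forall s, 0 <= qp s <= 1, forall s, 0 <= qm s <= 1
    & forall s, f s = qp s - qm s].
  move=> f1; exists (fun s => Num.max (f s) 0), (fun s => Num.max (- f s) 0).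
  split=> s; have /andP[fm fM] := f1 s.
  - by rewrite le_max lexx orbT ge_max fM ler01.
  - by rewrite le_max lexx orbT ge_max lerNl fm ler01.
  - by case: (leP (f s) 0) => f0; case: leP; lra.
have riesz (f : S -> R) : (forall s, -1 <= f s <= 1) ->
  exists qp qm : S -> R,
    [/\ positive_definite (riesz_coxeter qp),
        positive_definite (riesz_coxeter qm)
      & forall s : S, (f s)%:C =
          riesz_coxeter qp (val s) - riesz_coxeter qm (val s)].
  move=> /split_sign[qp [qm [qp01 qm01 fE]]]; exists qp, qm.
  split; [exact: riesz_coxeter_positive_definite hWS _ _..|].
  by move=> s; rewrite !(riesz_coxeter_generator hWS) fE rmorphB.
split=> [f /riesz[qp [qm H]]|f /riesz[qp [qm [pdp pdm fE]]]].
  by exists (riesz_coxeter qp), (riesz_coxeter qm).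
exists qp, qm.
have [] := FS_norm_sub_le (r := 2) pdp pdm; last by split.
by rewrite !(riesz_coxeter1 hWS) rmorph_nat.
Qed.
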